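(* Let $\lambda>-1$, $t\in\mathbb{R}$ and let $m\ge2$ be an integer. For $\kappa>-1$ let $\{P_n(x;\kappa)\}_{n\ge0}$ be the monic polynomials orthogonal with respect to the weight $|x|^{2\kappa+1}\exp(tx^2-x^{2m})$ on $\mathbb{R}$. Then $$xP_{2n}(x;\lambda+1)=P_{2n+1}(x;\lambda)\qquad(n\ge0),$$ $$x^2P_{2n-1}(x;\lambda+1)=xP_{2n}(x;\lambda)-\left\{\beta_{2n}(\lambda)+\frac{P_{2n+1}'(0;\lambda)}{P_{2n-1}'(0;\lambda)}\right\}P_{2n-1}(x;\lambda)\qquad(n\ge1).$$
   Context: For each $\kappa>-1$, $\beta_n(\kappa)$ denotes the recurrence coefficient in $P_{n+1}(x;\kappa)=xP_n(x;\kappa)-\beta_n(\kappa)P_{n-1}(x;\kappa)$, $P_{-1}=0$, $P_0=1$ ($m$ and $t$ are fixed and suppressed from the notation). The prime denotes differentiation with respect to $x$. *)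

(* Defs.v *)
From mathcomp Require Import all_boot all_order all_algebra.
From mathcomp Require Import all_classical all_reals all_analysis.

Set Implicit Arguments.
Unset Strict Implicit.
Unset Printing Implicit Defensive.
Import Order.TTheory GRing.Theory Num.Theory.
Local Open Scope classical_set_scope.
Local Open Scope ring_scope.

(* At [x = 0] with a negative exponent [`^] returns 0 instead of [+oo]; this is
   one point, hence of Lebesgue measure zero. *)
Definition weight (R : realType) (m : nat) (t kappa : R) (x : R) : R :=
  `|x| `^ (2 * kappa + 1) * expR (t * x ^+ 2 - x ^+ (2 * m)).

(* The integral is the extended-real one, so it cannot vanish merely because
   the integrand fails to be integrable: a null value forces the integrals of
   the positive and negative parts to be finite, as [+oo - +oo] is [-oo]. *)
Definition monic_orthogonal (R : realType) (w : R -> R) (P : nat -> {poly R}) :=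
  [/\ forall n, P n \is monic,
      forall n, size (P n) = n.+1
    & forall i j, i != j ->
        (\int[@lebesgue_measure R]_(x in [set: R])
           ((P i).[x] * (P j).[x] * w x)%:E = 0)%E].

(* [P_(n-1)], with [P_(-1) = 0]. *)
Definition prev_poly (R : realType) (P : nat -> {poly R}) (n : nat) : {poly R} :=
  if n is k.+1 then P k else 0.

(* [xget] picks an element of the set, or 0 if it is empty; [recurrence_coefE]
   shows that for [n > 0] there is at most one. (For [n = 0] the value is
   irrelevant, since [P_(-1) = 0].) *)
Definition recurrence_coef (R : realType) (P : nat -> {poly R}) (n : nat) : R :=
  xget 0 [set b : R | P n.+1 = 'X * P n - b *: prev_poly P n].

Lemma recurrence_coefE (R : realType) (P : nat -> {poly R}) (n : nat) (b : R) :
  P n != 0 -> P n.+2 = 'X * P n.+1 - b *: P n -> recurrence_coef P n.+1 = b.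
Proof.
move=> Pn0 Pb; apply: xget_unique => //= c; rewrite Pb => /addrI/oppr_inj/eqP.
by rewrite -subr_eq0 -scalerBl scaler_eq0 (negbTE Pn0) orbF subr_eq0 => /eqP.
Qed.

(* Main.v *)
Require Import Defs.
From HB Require Import structures.
From mathcomp Require Import all_boot all_order all_algebra.
From mathcomp Require Import all_classical all_reals all_analysis.
From mathcomp Require Import measurable_realfun.
From mathcomp Require Import ring lra zify.
Set Implicit Arguments.
Unset Strict Implicit.
Unset Printing Implicit Defensive.
Import Order.TTheory GRing.Theory Num.Theory.
Local Open Scope classical_set_scope.
Local Open Scope ring_scope.

(** Write [L p] for the integral of [p] against the weight of parameter
[lambda], and [L'] for the same functional at [lambda + 1]. The two weights
differ by the factor [x ^+ 2], so [L' p = L ('X^2 * p)], and both identities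
are instances of Christoffel's transformation, which holds for any even
functional [L] with [L (p * p) != 0] for [p != 0].

The argument rests on uniqueness ([monic_ops_unique]): a monic polynomial of
degree [n] that is [L']-orthogonal to the members of degree less than [n] of
the [L']-orthogonal family is its [n]-th member. To identify the [n]-th
polynomial for [L'] it is therefore enough to find a combination of polynomials
of the [L]-family, of high enough index, that is divisible by ['X] or ['X^2].

- By evenness the polynomials of odd index vanish at [0] ([ops_odd_at0]), so
  [P (2 * n + 1)] is ['X] times a monic polynomial of degree [2 * n], which is
  [L']-orthogonal to everything of lower degree ([christoffel_X]).

- For the second identity, subtract from ['X * P (2 * n)] the multiple of
  [P (2 * n - 1)] that kills the coefficient of ['X]; the difference is
  divisible by ['X^2] and its quotient is again orthogonal to everything of
  lower degree ([christoffel_Xsq]). Differentiating the three-term recurrence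
  at [0] turns that multiple into the bracket of the statement. The division by
  the derivative of [P (2 * n - 1)] at [0] is legitimate because a root at [0]
  is simple ([ops_simple_root0]).

It remains to see that [L] is a well-defined linear functional, that is, that
all moments are finite. This is derived from orthogonality itself
([orthogonal_moment_finite]): an integral equal to [0] is finite, so the
integrals of [P 1] and [P 2] against the weight converge; positivity prevents
[P 2] from being in the ideal of [P 1], and then [`|P 1| + `|P 2 - a *: P 1|]
is bounded below for a suitable [a], which makes the weight itself
integrable. *)

(** * Orthogonal polynomials of a linear functional *)

Section OrthogonalPolynomials.
Context (F : realFieldType).
Implicit Types (L : {scalar {poly F}}) (P Q : nat -> {poly F}) (p q : {poly F}).

Definition definite_functional L := forall p, p != 0 -> L (p * p) != 0.

Definition monic_ops L P :=
  [/\ forall n, P n \is monic,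
      forall n, size (P n) = n.+1
    & forall i j, i != j -> L (P i * P j) = 0].

(** The part of [monic_ops] that makes [P 0, ..., P n.-1] a basis of the
polynomials of size at most [n]; it does not refer to a functional, so it can
be used before the integral is known to be one. *)
Definition monic_family P :=
  (forall n, P n \is monic) /\ (forall n, size (P n) = n.+1).

Lemma monic_ops_family L P : monic_ops L P -> monic_family P.
Proof. by case. Qed.

Lemma size_XM P n : monic_family P -> size ('X * P n) = n.+2.
Proof. by move=> [mP sP]; rewrite mulrC size_mulX ?sP ?monic_neq0. Qed.

Lemma size_sub_lead P n p : monic_family P ->
  (size p <= n.+1)%N -> (size (p - p`_n *: P n)%R <= n)%N.
Proof.
move=> [mP sP] sp; apply/leq_sizeP => j; rewrite leq_eqVlt => /orP[/eqP<-|nj].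
  have := mP n; rewrite monicE /lead_coef sP /= => /eqP PnE.
  by rewrite !coefE PnE mulr1 subrr.
rewrite !coefE (nth_default _ (leq_trans sp nj)).
by rewrite (@nth_default _ 0 (P n)) ?sP// mulr0 subr0.
Qed.

Lemma orthogonal_lower L P p n : monic_family P ->
  (forall j, (j < n)%N -> L (p * P j) = 0) ->
  forall q, (size q <= n)%N -> L (p * q) = 0.
Proof.
move=> fP; elim: n => [|n IHn] pP q sq.
  by move: sq; rewrite leqn0 size_poly_eq0 => /eqP->; rewrite mulr0 linear0.
rewrite -(subrK (q`_n *: P n) q) mulrDr linearD/= -scalerAr scalarZ pP//.
rewrite mulr0 addr0 IHn ?size_sub_lead// => j jn; apply: pP; exact: ltnW.
Qed.

Lemma ops_lower L P n q : monic_ops L P -> (size q <= n)%N -> L (P n * q) = 0.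
Proof.
move=> [mP sP oP]; apply: (@orthogonal_lower _ P) => // j jn; apply: oP.
by rewrite gtn_eqF.
Qed.

Lemma orthogonal_lower_eq0 L P p n : definite_functional L -> monic_family P ->
  (size p <= n)%N -> (forall j, (j < n)%N -> L (p * P j) = 0) -> p = 0.
Proof.
move=> Ldef fP sp pP; apply/eqP; apply: contraT => /Ldef/eqP[].
exact: (orthogonal_lower fP pP).
Qed.

(** The difference of two such polynomials has degree less than [n] and is
orthogonal to every polynomial of degree less than [n], hence to itself. *)
Lemma monic_ops_unique L P p n : definite_functional L -> monic_ops L P ->
  p \is monic -> size p = n.+1 ->
  (forall j, (j < n)%N -> L (p * P j) = 0) -> p = P n.
Proof.
move=> Ldef oP mp sp pP; have fP := monic_ops_family oP.
have := mp; rewrite monicE /lead_coef sp /= => /eqP pnE.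
apply/eqP; rewrite -subr_eq0 -[P n]scale1r -{1}pnE; apply/eqP.
apply: (@orthogonal_lower_eq0 L P _ n) => //; first by rewrite size_sub_lead ?sp.
move=> j jn; rewrite mulrBl linearB/= pP// -scalerAl scalarZ.
by rewrite (ops_lower oP) ?mulr0 ?subrr// fP.2.
Qed.

(** Reflecting [P n] preserves its orthogonality to lower degrees, and the sign
makes it monic again, so uniqueness applies. *)
Lemma ops_parity L P n : definite_functional L ->
  (forall p, L (p \Po (- 'X)) = L p) -> monic_ops L P ->
  P n \Po (- 'X) = (-1) ^+ n *: P n.
Proof.
move=> Ldef Leven oP; have [mP sP] := monic_ops_family oP.
have sX : size (- 'X : {poly F}) = 2%N by rewrite size_polyN size_polyX.
have sgnn : (-1) ^+ n * (-1) ^+ n = 1 :> F.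
  by rewrite -expr2 exprAC sqrrN !expr1n.
have XK p : p \Po (- 'X) \Po (- 'X) = p.
  by rewrite -comp_polyA raddfN/= comp_polyX opprK comp_polyXr.
suff {2}<- : (-1) ^+ n *: (P n \Po (- 'X)) = P n by rewrite scalerA sgnn scale1r.
apply: (monic_ops_unique Ldef oP).
- rewrite monicE lead_coefZ lead_coef_comp ?sX// sP (monicP (mP n)).
  by rewrite lead_coefN lead_coefX mul1r sgnn.
- by rewrite size_scale ?signr_eq0// size_comp_poly2.
move=> j jn; rewrite -scalerAl scalarZ -[P j]XK -comp_polyM Leven.
by rewrite (ops_lower oP) ?mulr0// size_comp_poly2// sP.
Qed.

Lemma ops_odd_at0 L P n : definite_functional L ->
  (forall p, L (p \Po (- 'X)) = L p) -> monic_ops L P -> odd n ->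
  (P n).[0] = 0.
Proof.
move=> Ldef Leven oP on; have := ops_parity n Ldef Leven oP.
move/(congr1 (horner ^~ 0)); rewrite horner_comp !hornerE oppr0 -signr_odd on.
rewrite expr1; lra.
Qed.

(** Expanding ['X * P n.+1 - P n.+2] over the family, only the terms of index
[n.+1] and [n] can survive, because multiplication by ['X] is self-adjoint. The
first one vanishes since ['X * P n.+1 ^+ 2] is odd. *)
Lemma ops_three_term L P n : definite_functional L ->
  (forall p, L (p \Po (- 'X)) = L p) -> monic_ops L P ->
  exists b, P n.+2 = 'X * P n.+1 - b *: P n.
Proof.
move=> Ldef Leven oP; have fP := monic_ops_family oP; have [mP sP] := fP.
have XP0 : L ('X * P n.+1 * P n.+1) = 0.
  have := Leven ('X * P n.+1 * P n.+1); rewrite !comp_polyM comp_polyX.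
  rewrite (ops_parity n.+1 Ldef Leven oP) -2!scalerAr -scalerAl scalerA.
  rewrite -expr2 exprAC sqrrN !expr1n scale1r !mulNr linearN/=; lra.
set d := 'X * P n.+1 - P n.+2.
have sd : (size d <= n.+2)%N.
  have /(size_sub_lead fP) : (size ('X * P n.+1)%R <= n.+3)%N.
    by rewrite size_XM.
  rewrite coefXM/=; have := mP n.+1; rewrite monicE /lead_coef sP => /eqP/=->.
  by rewrite scale1r.
(* [s] is what remains after removing the components on [P n.+1] and [P n]. *)
pose r := d - d`_n.+1 *: P n.+1; pose s := r - r`_n *: P n.
have sr : (size r <= n.+1)%N by rewrite size_sub_lead.
have ss : (size s <= n)%N by rewrite size_sub_lead.
have s0 : s = 0.
  apply: (@orthogonal_lower_eq0 L P _ n) => // j jn.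
  rewrite /s /r /d !mulrBl !linearB/= -!scalerAl !scalarZ.
  rewrite [_ * P n.+1]mulrC -mulrA !(ops_lower oP) ?sP ?size_XM//; last 2 first.
  - exact: ltnW.
  - exact: (ltn_trans jn).
  by rewrite !mulr0 !subr0.
have dE : d = d`_n.+1 *: P n.+1 + r`_n *: P n.
  by move: s0; rewrite /s /r => /eqP; rewrite subr_eq0 => /eqP <-; rewrite subrKC.
have : L (d * P n.+1) = 0.
  by rewrite mulrBl linearB/= XP0 (ops_lower oP) ?subr0// sP.
rewrite {1}dE mulrDl linearD/= -!scalerAl !scalarZ [P n * _]mulrC.
rewrite [L (P n.+1 * P n)](ops_lower oP) ?sP// mulr0 addr0 => /eqP.
rewrite mulf_eq0 (negbTE (Ldef _ _)) ?monic_neq0// orbF => /eqP d0.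
exists r`_n; have <- : d = r`_n *: P n by rewrite {1}dE d0 scale0r add0r.
by rewrite subKr.
Qed.

Lemma low_coefs_eq0_factor n p : (forall i, (i < n)%N -> p`_i = 0) ->
  p = drop_poly n p * 'X^n.
Proof.
move=> p0; rewrite -{1}[p](poly_take_drop n) [take_poly _ _](_ : _ = 0) ?add0r//.
by apply/polyP => i; rewrite coef_take_poly coef0; case: ifP => // /p0.
Qed.

(** If [P n = 'X^2 * V], then [L (('X * V) * ('X * V)) = L (P n * V)], which is
[0] since [V] has lower degree than [P n]: this contradicts definiteness. *)
Lemma ops_simple_root0 L P n : definite_functional L -> monic_ops L P ->
  (P n).[0] = 0 -> (P n)^`().[0] != 0.
Proof.
move=> Ldef oP; rewrite !horner_coef0 coef_deriv mulr1n => Pn0.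
apply/negP => /eqP Pn1; have [mP sP] := monic_ops_family oP.
have PnE : P n = drop_poly 2 (P n) * 'X^2.
  by apply: low_coefs_eq0_factor => -[|[|i]].
set V := drop_poly 2 (P n) in PnE.
have V0 : V != 0.
  by apply: contraNneq (monic_neq0 (mP n)) => V0; rewrite PnE V0 mul0r.
have /Ldef/eqP[] : 'X * V != 0 by rewrite mulf_neq0 ?polyX_eq0.
rewrite (_ : _ * _ = P n * V); last by rewrite PnE; ring.
by rewrite (ops_lower oP)// size_drop_poly sP; lia.
Qed.

Lemma monicMXn_inv p n : p * 'X^n \is monic -> p \is monic.
Proof. by rewrite !monicE lead_coefM lead_coefXn mulr1. Qed.

Lemma definite_mulX L L' : definite_functional L ->
  (forall p, L' p = L ('X^2 * p)) -> definite_functional L'.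
Proof.
move=> Ldef L'E p p0; rewrite L'E (_ : _ * _ = ('X * p) * ('X * p)); last by ring.
by apply: Ldef; rewrite mulf_neq0 ?polyX_eq0.
Qed.

(** The quotient [S] of [P n.+1] by ['X] satisfies
[L' (S * q) = L (P n.+1 * ('X * q))], which vanishes when [q] has degree less
than [n]. *)
Lemma christoffel_X L L' P Q n : definite_functional L ->
  (forall p, L' p = L ('X^2 * p)) -> monic_ops L P -> monic_ops L' Q ->
  (P n.+1).[0] = 0 -> 'X * Q n = P n.+1.
Proof.
move=> Ldef L'E oP oQ; rewrite horner_coef0 => Pn0.
have L'def := definite_mulX Ldef L'E.
have [mP sP] := monic_ops_family oP; have [mQ sQ] := monic_ops_family oQ.
have PnE : P n.+1 = drop_poly 1 (P n.+1) * 'X^1.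
  by apply: low_coefs_eq0_factor => -[|i].
set S := drop_poly 1 _ in PnE.
rewrite PnE expr1 mulrC; congr (_ * _); apply/esym.
apply: (monic_ops_unique L'def oQ).
- by apply: (@monicMXn_inv _ 1); rewrite -PnE.
- by rewrite size_drop_poly sP subn1.
move=> j jn; rewrite L'E (_ : _ * _ = P n.+1 * ('X * Q j)); last first.
  by rewrite PnE; ring.
by rewrite (ops_lower oP)// size_XM.
Qed.

(** By the recurrence [Pb], the factor of [P n] on the right-hand side is just
[(P n.+1).[0] / (P n)^`().[0]], the one for which that side is divisible by
['X^2]. The quotient [V] by ['X^2] then satisfies
[L' (V * q) = L (('X * P n.+1 - c *: P n) * q)], where both terms vanish when
[q] has degree less than [n]. *)
Lemma christoffel_Xsq L L' P Q n b : definite_functional L ->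
  (forall p, L' p = L ('X^2 * p)) -> monic_ops L P -> monic_ops L' Q ->
  (P n).[0] = 0 -> P n.+2 = 'X * P n.+1 - b *: P n ->
  'X^2 * Q n = 'X * P n.+1 - (b + (P n.+2)^`().[0] / (P n)^`().[0]) *: P n.
Proof.
move=> Ldef L'E oP oQ Pn0 Pb.
have L'def := definite_mulX Ldef L'E.
have Pn1 := ops_simple_root0 Ldef oP Pn0.
have [mP sP] := monic_ops_family oP; have [mQ sQ] := monic_ops_family oQ.
set c := (X in X *: P n).
have cE : c * (P n)^`().[0] = (P n.+1).[0].
  rewrite /c Pb mulrDl mulfVK// derivB derivM derivX derivZ mul1r
    !(hornerD, hornerN, hornerM, hornerX, hornerZ); ring.
set T := 'X * P n.+1 - c *: P n.
have T0 : T`_0 = 0.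
  rewrite -horner_coef0 /T !(hornerD, hornerN, hornerM, hornerX, hornerZ) Pn0.
  by ring.
have T1 : T`_1 = 0.
  rewrite -[LHS]mulr1n -coef_deriv -horner_coef0 /T.
  rewrite derivB derivM derivX derivZ mul1r.
  by rewrite !(hornerD, hornerN, hornerM, hornerX, hornerZ) cE; ring.
have TE : T = drop_poly 2 T * 'X^2.
  by apply: low_coefs_eq0_factor => -[|[|i]].
set V := drop_poly 2 T in TE.
have sXP : size ('X * P n.+1) = n.+3 by exact: size_XM.
have lt : (size (- (c *: P n))%R < size ('X * P n.+1)%R)%N.
  rewrite size_polyN sXP (leq_ltn_trans (size_scale_leq _ _))// sP; lia.
rewrite TE mulrC; congr (_ * _); apply/esym.
apply: (monic_ops_unique L'def oQ).
- apply: (@monicMXn_inv _ 2); rewrite -TE monicE lead_coefDl// lead_coefM.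
  by rewrite lead_coefX mul1r -monicE.
- by rewrite size_drop_poly size_polyDl// sXP subn2.
move=> j jn; rewrite L'E mulrA [_ * V]mulrC -TE mulrBl linearB/=.
rewrite -scalerAl scalarZ [_ * P n.+1]mulrC -mulrA !(ops_lower oP) ?sQ//.
  by rewrite mulr0 subr0.
by rewrite size_XM// ltnS ltnW.
Qed.

End OrthogonalPolynomials.

(** * Finiteness of the moments *)

Section Moments.
Context (R : realType).
Local Notation mu := (@lebesgue_measure R).
Implicit Types (w : R -> R) (p q : {poly R}).

Lemma integralN_reflect (f : R -> \bar R) : measurable_fun [set: R] f ->
  (\int[mu]_x f (- x)%R = \int[mu]_x f x)%E.
Proof.
have mN : measurable_fun [set: measurableTypeR R]
    (-%R : measurableTypeR R -> measurableTypeR R).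
  exact: oppr_measurable.
have ge0 (g : R -> \bar R) : measurable_fun [set: R] g -> (forall x, 0 <= g x)%E ->
    (\int[mu]_x g (- x)%R = \int[mu]_x g x)%E.
  move=> mg g0; rewrite -[LHS](ge0_integral_pushforward mN mu measurableT mg)//.
  by apply: eq_measure_integral => //= A mA _; exact: lebesgue_measureN.
move=> mf; rewrite integralE [RHS]integralE; congr (_ - _)%E.
- rewrite -[RHS]ge0//; last exact: measurable_funepos.
  by apply: eq_integral => x _; rewrite !funeposE.
- rewrite -[RHS]ge0//; last exact: measurable_funeneg.
  by apply: eq_integral => x _; rewrite !funenegE.
Qed.

(** The extended reals use [+oo - +oo = -oo], so a finite difference of two
nonnegative quantities forces both of them to be finite. *)
Lemma fin_num_integral_integrable (f : R -> \bar R) : measurable_fun [set: R] f ->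
  (\int[mu]_x f x)%E \is a fin_num -> mu.-integrable setT f.
Proof.
move=> mf; rewrite integralE => ffin; apply/integrableP; split=> //.
have finD (a b : \bar R) : (0 <= a)%E -> (0 <= b)%E -> (a - b)%E \is a fin_num ->
    (a + b < +oo)%E.
  by case: a b => [a| |] [b| |]//=; rewrite -?EFinD ?ltry.
rewrite -[fun x => _]/(abse \o f) fune_abse ge0_integralD//.
- by apply: finD => //; exact: integral_ge0.
- exact: measurable_funepos.
- exact: measurable_funeneg.
Qed.

Lemma finite_roots p : p != 0 -> finite_set [set x | p.[x] = 0].
Proof.
have [n] := ubnP (size p); elim: n p => [//|n IHn] p sp p0.
have [[a pa]|noroot] := pselect (exists a, p.[a] = 0); last first.
  by rewrite (_ : mkset _ = set0)// -subset0 => x px; apply: noroot; exists x.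
have /factor_theorem[q pE] : root p a by apply/rootP.
have q0 : q != 0 by apply: contra_neq p0 => q0; rewrite pE q0 mul0r.
have sq : (size q < n)%N.
  by move: sp; rewrite pE size_Mmonic ?monicXsubC// size_XsubC addn2 ltnS.
apply: (@sub_finite_set _ _ ([set a] `|` [set x | q.[x] = 0])); last first.
  by rewrite finite_setU; split; [exact: finite_set1|exact: IHn].
move=> x /=; rewrite pE hornerM hornerXsubC => /eqP.
by rewrite mulf_eq0 subr_eq0 => /orP[/eqP ->|/eqP ->]; [right|left].
Qed.

Lemma ae_horner_neq0 p : p != 0 -> {ae mu, forall x, p.[x] != 0}.
Proof.
move=> p0; exists [set x | p.[x] = 0]; split.
- apply: countable_measurable; first by move=> x; exact: measurable_set1.
  exact/finite_set_countable/finite_roots.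
- exact/countable_lebesgue_measure0/finite_set_countable/finite_roots.
- by move=> x /negP; rewrite negbK => /eqP.
Qed.

Section FixedWeight.
Variable w : R -> R.
Hypothesis mw : measurable_fun [set: R] w.

(** Extended-real valued, so that it makes sense before integrability is
established. *)
Definition moment p : \bar R := (\int[mu]_x (p.[x] * w x)%:E)%E.

Definition moment_finite p : Prop :=
  mu.-integrable [set: R] (fun x => (p.[x] * w x)%:E).

Lemma measurable_horner_weight p :
  measurable_fun [set: R] (fun x => (p.[x] * w x)%:E).
Proof.
by apply/measurable_EFinP; apply: measurable_funM => //; exact: measurable_poly.
Qed.

Lemma moment_finiteP p : moment p \is a fin_num -> moment_finite p.
Proof.
move=> fp; apply: fin_num_integral_integrable => //.
exact: measurable_horner_weight.
Qed.

Lemma moment_finite_linear a p q : moment_finite p -> moment_finite q ->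
  moment_finite (a *: p + q) /\
  moment (a *: p + q) = (a%:E * moment p + moment q)%E.
Proof.
move=> fp fq; have fap := @integrableZl _ _ _ mu _ measurableT a _ fp.
rewrite /moment_finite /moment -integralZl//.
have E x : (((a *: p + q).[x] * w x)%:E =
  a%:E * (p.[x] * w x)%:E + (q.[x] * w x)%:E)%E.
  by rewrite hornerD hornerZ mulrDl -mulrA.
split; last by rewrite -integralD//; apply: eq_integral => x _; exact: E.
apply: eq_integrable (integrableD measurableT fap fq) => // x _.
Qed.

Lemma moment_finite_bound (c : R) p q r :
  (forall x, `|p.[x]| <= c * (`|q.[x]| + `|r.[x]|)) ->
  moment_finite q -> moment_finite r -> moment_finite p.
Proof.
move=> pqr fq fr.
have fqr := integrableD measurableT (integrable_abse fq) (integrable_abse fr).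
have := @integrableZl _ _ _ mu _ measurableT c _ fqr.
apply: le_integrable => //; first exact: measurable_horner_weight.
move=> x _; rewrite /= lee_fin !(normrM _ (w x)) -mulrDl mulrA normrM normr_id.
rewrite ler_wpM2r//; exact: le_trans (pqr x) (ler_norm _).
Qed.

Hypothesis w_ge0 : forall x, 0 <= w x.
Hypothesis w_ae_gt0 : {ae mu, forall x, 0 < w x}.

(** Stated for the extended-real integral, so that it can be used before any
moment is known to be finite. *)
Lemma moment_sqr_neq0 p : p != 0 -> moment (p * p) != 0%E.
Proof.
move=> p0; apply/eqP => pp0.
have : (\int[mu]_x `|((p * p).[x] * w x)%:E| = 0)%E.
  rewrite -[RHS]pp0; apply: eq_integral => x _.
  by rewrite gee0_abs// lee_fin mulr_ge0// hornerM -expr2 sqr_ge0.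
move/(ae_eq_integral_abs mu measurableT (measurable_horner_weight _)) => ae0.
have aeF : {ae mu, forall x, False}.
  apply: filterS3 ae0 w_ae_gt0 (ae_horner_neq0 p0) => x /(_ I)[ppw w0 px].
  have := lt0r_neq0 w0; apply/negP; move/eqP: ppw.
  by rewrite hornerM !mulf_eq0 (negbTE px)/= negbK.
have [A [mA A0 FA]] := aeF.
have : (mu [set: R] <= mu A)%E.
  by apply: le_measure; rewrite ?inE// => x _; exact: FA.
by rewrite A0 -set_itvNyy lebesgue_measure_itv.
Qed.

(** Since [b != 0], the two terms cannot be small together: either [y] is
bounded below, or [y ^+ 2] is too small to cancel [b]. *)
Lemma sqrD_dominates_cst (b : R) : b != 0 ->
  exists2 d, 0 < d & forall y : R, 0 <= y -> d <= `|y ^+ 2 + b| + y.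
Proof.
move=> b0; exists (Num.min 1 (`|b| / 2)).
  by rewrite lt_min ltr01 divr_gt0// normr_gt0.
move=> y y0; set d := Num.min _ _.
have [d1 d2] : d <= 1 /\ d <= `|b| / 2 by rewrite !ge_min !lexx orbT.
have [dy|yd] := leP d y; first by rewrite ler_wpDl.
have : `|b| <= `|y ^+ 2 + b| + y ^+ 2.
  rewrite -[leLHS](ger0_norm) ?normr_ge0// normr_id.
  rewrite -{1}(addrK (y ^+ 2) b) [b + _]addrC (le_trans (ler_normB _ _))//.
  by rewrite [`|y ^+ 2|]ger0_norm ?sqr_ge0.
nra.
Qed.

(** As [P 0 = 1], orthogonality makes the integrals of [P n.+1] against the
weight vanish, hence converge. For a suitable [a] the polynomial
[r = P 2 - a *: P 1] has the form [P 1 ^+ 2 + b]. If [b] were [0], the square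
of [P 1] would have integral [0]. So [b != 0], the constant [1] is dominated by
a multiple of [`|r| + `|P 1|], and the weight is integrable. The polynomials
[P n] are then all integrable against it, and they span. *)
Lemma orthogonal_moment_finite P :
  monic_orthogonal w P -> forall p, moment_finite p.
Proof.
move=> [mP sP oP].
have fP : monic_family P by [].
have P0 : P 0%N = 1.
  have := mP 0%N; have /size1_polyC P0 : (size (P 0%N) <= 1)%N by rewrite sP.
  by rewrite P0 monicE lead_coefC => /eqP ->.
have PS n : moment (P n.+1) = 0%E.
  have := oP 0%N n.+1 isT; rewrite P0 => <-.
  by apply: eq_integral => x _; rewrite hornerC mul1r.
have fPS n : moment_finite (P n.+1) by apply: moment_finiteP; rewrite PS.
have P1E : (P 1%N)`_1 = 1.
  by have := mP 1%N; rewrite monicE lead_coefE sP => /eqP.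
have mPP : P 1%N * P 1%N \is monic by rewrite monicMl.
have sPP : size (P 1%N * P 1%N) = 3%N by rewrite size_monicM ?monic_neq0// !sP.
pose a := (P 2%N)`_1 - (P 1%N * P 1%N)`_1.
have [fr r0] := moment_finite_linear (- a) (fPS 0%N) (fPS 1%N).
set r := _ + _ in fr r0; rewrite !PS mule0 adde0 in r0.
pose b := (r - P 1%N * P 1%N)`_0.
have rE : r = P 1%N * P 1%N + b%:P.
  apply/eqP; rewrite addrC -subr_eq; apply/eqP/size1_polyC/leq_sizeP.
  move=> [|[|[|j]]]// _; rewrite /r !coefD coefN coefZ.
  - by rewrite P1E /a; ring.
  - rewrite [(P 1%N)`_2]nth_default ?sP// mulr0 add0r.
    have := mP 2%N; have := mPP; rewrite !monicE !lead_coefE sPP sP/=.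
    by move=> /eqP-> /eqP->; rewrite subrr.
  - by rewrite !nth_default ?sP ?sPP// mulr0 addr0 subr0.
have b0 : b != 0.
  apply: contra_eq_neq r0 => b0; rewrite rE b0 addr0 moment_sqr_neq0//.
  exact: monic_neq0.
have [d d0 db] := sqrD_dominates_cst b0.
have f1 : moment_finite 1.
  apply: (moment_finite_bound (c := d^-1) _ fr (fPS 0%N)) => x.
  rewrite hornerC normr1 ler_pdivlMl// mulr1 rE hornerD hornerC hornerM -expr2.
  by rewrite -[_ ^+ 2]real_normK ?num_real//; exact: db.
have fPn n : moment_finite (P n) by case: n => [|n]; rewrite ?P0.
move=> p; have [n] := ubnP (size p); elim: n p => [//|n IHn] p sp.
case: n IHn sp => [_|n IHn sp].
  rewrite ltnS leqn0 size_poly_eq0 => /eqP ->.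
  by have [] := moment_finite_linear (-1) f1 f1; rewrite scaleN1r addNr.
rewrite -(subrK (p`_n *: P n) p) addrC.
by have [] := moment_finite_linear p`_n (fPn n) (IHn _ (size_sub_lead fP sp)).
Qed.

End FixedWeight.

Lemma moment_functional (w : R -> R) :
  (forall p, moment_finite w p) ->
  exists L : {scalar {poly R}}, forall p, moment w p = (L p)%:E.
Proof.
move=> fw; pose f p := fine (moment w p).
have fE p : moment w p = (f p)%:E.
  by rewrite fineK//; apply: integrable_fin_num => //; exact: fw.
have f_lin : linear_for *%R f.
  move=> a p q; rewrite /f (moment_finite_linear a (fw p) (fw q)).2.
  by rewrite !fE -EFinM -EFinD.
pose L : {scalar {poly R}} :=
  HB.pack f (GRing.isLinear.Build R {poly R} R *%R f f_lin).
by exists L.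
Qed.

(** The bridge from integrals to the algebraic theory: for a weight that is
positive almost everywhere, integration is a genuine definite functional. *)
Lemma monic_orthogonal_functional (w : R -> R) P : measurable_fun [set: R] w ->
  (forall x, 0 <= w x) -> {ae mu, forall x, 0 < w x} -> monic_orthogonal w P ->
  exists L : {scalar {poly R}}, [/\ forall p, moment w p = (L p)%:E,
    definite_functional L & monic_ops L P].
Proof.
move=> mw w0 w1 oP; have [mP sP oP'] := oP.
have [L LE] := moment_functional (orthogonal_moment_finite mw w0 w1 oP).
exists L; split=> //.
  by move=> p /(moment_sqr_neq0 mw w0 w1); rewrite LE eqe.
split=> // i j /oP' ij; apply/EFin_inj; rewrite -LE -[RHS]ij.
by apply: eq_integral => x _; rewrite hornerM.
Qed.

Lemma momentN (w : R -> R) p : measurable_fun [set: R] w ->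
  (forall x, w (- x) = w x) -> moment w (p \Po (- 'X)) = moment w p.
Proof.
move=> mw wN; rewrite /moment.
rewrite -[RHS](integralN_reflect (measurable_horner_weight mw p)).
by apply: eq_integral => x _; rewrite horner_comp hornerN hornerX wN.
Qed.

End Moments.

(** * The weight and its shift in the parameter *)

Section Weight.
Context (R : realType).
Implicit Types (m : nat) (t kappa x : R) (p : {poly R}).
Local Notation mu := (@lebesgue_measure R).

Lemma measurable_weight m t kappa : measurable_fun [set: R] (weight m t kappa).
Proof.
apply: measurable_funM.
  apply: (@measurableT_comp _ _ _ R R R (@powR R ^~ (2 * kappa + 1))
    setT (@Num.norm R R)).
    exact: measurable_powR.
  exact: normr_measurable.
apply: measurableT_comp => //; apply: measurable_funB; last exact: measurable_funX.
by apply: measurable_funM => //; exact: measurable_funX.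
Qed.

Lemma weight_ge0 m t kappa x : 0 <= weight m t kappa x.
Proof. by rewrite mulr_ge0// ?powR_ge0// expR_ge0. Qed.

Lemma weight_ae_gt0 m t kappa : {ae mu, forall x, 0 < weight m t kappa x}.
Proof.
have X0 : 'X != 0 :> {poly R} by rewrite polyX_eq0.
apply: negligibleS (ae_horner_neq0 X0) => x; apply: contra_not => /=.
by rewrite hornerX => x0; rewrite mulr_gt0 ?expR_gt0// powR_gt0 ?normr_gt0.
Qed.

Lemma weightN m t kappa x : weight m t kappa (- x) = weight m t kappa x.
Proof. by rewrite /weight normrN sqrrN !(exprM _ 2) sqrrN. Qed.

Lemma weightD1 m t kappa x : -1 < kappa ->
  weight m t (kappa + 1) x = x ^+ 2 * weight m t kappa x.
Proof.
move=> k1; rewrite /weight mulrA; congr (_ * _).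
have [->|x0] := eqVneq x 0.
  (* The exponent on the left is nonzero because it exceeds [1]. *)
  by rewrite normr0 powR0 ?expr0n ?mul0r//; apply: lt0r_neq0; lra.
rewrite (_ : 2 * (kappa + 1) + 1 = 2 + (2 * kappa + 1)); last by ring.
rewrite powRD ?normr_eq0 ?x0 ?implybT// powR_mulrn//.
by rewrite real_normK ?num_real.
Qed.

Lemma moment_weightD1 m t kappa p : -1 < kappa ->
  moment (weight m t (kappa + 1)) p = moment (weight m t kappa) ('X^2 * p).
Proof.
move=> k1; apply: eq_integral => x _.
by rewrite weightD1// hornerM hornerXn; congr (_%:E); ring.
Qed.

End Weight.

(** * The two identities *)

Theorem theorem5p2 (R : realType) (lambda t : R) (m : nat)
    (P : R -> nat -> {poly R}) (hlambda : -1 < lambda) (hm : (2 <= m)%N)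
    (hP : forall kappa : R, -1 < kappa ->
            monic_orthogonal (weight m t kappa) (P kappa)) :
  let beta (kappa : R) (n : nat) := recurrence_coef (P kappa) n in
  (forall n : nat,
     'X * P (lambda + 1) (2 * n)%N = P lambda (2 * n + 1)%N) /\
  (forall n : nat, (1 <= n)%N ->
     'X^2 * P (lambda + 1) (2 * n - 1)%N =
       'X * P lambda (2 * n)%N
       - (beta lambda (2 * n)%N
          + (P lambda (2 * n + 1)%N)^`().[0] / (P lambda (2 * n - 1)%N)^`().[0])
         *: P lambda (2 * n - 1)%N).
Proof.
have functional kappa (hk : -1 < kappa) := monic_orthogonal_functional
  (measurable_weight m t kappa) (@weight_ge0 R m t kappa)
  (weight_ae_gt0 m t kappa) (hP kappa hk).
have [L [LE Ldef oP]] := functional lambda hlambda.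
have [|L' [L'E _ oQ]] := functional (lambda + 1); first by lra.
have L'L p : L' p = L ('X^2 * p).
  by apply/EFin_inj; rewrite -L'E moment_weightD1// LE.
have Leven p : L (p \Po (- 'X)) = L p.
  apply/EFin_inj; rewrite -!LE momentN//; first exact: measurable_weight.
  exact: weightN.
have odd0 n : odd n -> (P lambda n).[0] = 0.
  exact: (ops_odd_at0 Ldef Leven oP).
split=> [n|[//|k] _].
  rewrite addn1; apply: (christoffel_X Ldef L'L) => //; apply: odd0.
  by rewrite /= oddM.
rewrite (_ : 2 * k.+1 - 1 = (2 * k).+1)%N; last by lia.
rewrite (_ : 2 * k.+1 + 1 = (2 * k).+3)%N; last by lia.
rewrite (_ : 2 * k.+1 = (2 * k).+2)%N; last by lia.
have [b Pb] := ops_three_term (2 * k).+1 Ldef Leven oP.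
rewrite (recurrence_coefE _ Pb); last by apply: monic_neq0; case: oP.
by apply: (christoffel_Xsq Ldef L'L) => //; apply: odd0; rewrite /= oddM.
Qed.
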